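(* Let $m\leqslant n$, let $A\in\mathbb{R}^{n\times n}$ be nonsymmetric positive definite and let $B\in\mathbb{R}^{m\times n}$ be rank-deficient. Let $Q\in\mathbb{R}^{m\times m}$ be symmetric positive definite and, for each $\alpha>0$, let $H_\alpha\in\mathbb{R}^{n\times n}$ be a symmetric positive definite matrix, such that $H_\alpha\to 0$ as $\alpha\to 0$. Then $n$ eigenvalues (counted with multiplicity) of the preconditioned matrix $\mathcal{K}_\alpha^{-1}\mathcal{A}$ tend to $1$ as $\alpha\to 0$. The rest of the eigenvalues of $\mathcal{K}_\alpha^{-1}\mathcal{A}$ are of the form $$\gamma_\alpha=\frac{r_\alpha}{q_\alpha+r_\alpha},$$ where $r_\alpha$ is a complex number with $\Re(r_\alpha)\geqslant 0$ and $q_\alpha>0$.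
   Context: A (nonsymmetric) matrix $A\in\mathbb{R}^{n\times n}$ is called positive definite if $x^TAx>0$ for all $0\neq x\in\mathbb{R}^n$ (''nonsymmetric'' means symmetry is not assumed). ''$B$ is rank-deficient'' means $\mathrm{rank}(B)<m\leqslant n$. Define $$\mathcal{A}=\begin{pmatrix}A & B^T\\ -B & 0\end{pmatrix},\qquad \mathcal{K}_\alpha=\begin{pmatrix}H_\alpha&0\\0&Q\end{pmatrix}+\mathcal{A}=\begin{pmatrix}H_\alpha+A & B^T\\ -B & Q\end{pmatrix},$$ which is nonsingular. $\Re(z)$ denotes the real part of a complex number $z$. *)

(* Defs.v *)
From HB Require Import structures.
From mathcomp Require Import all_boot all_order all_algebra.
From mathcomp Require Import complex.
From mathcomp Require Import all_classical all_reals all_analysis.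

Set Implicit Arguments.
Unset Strict Implicit.
Unset Printing Implicit Defensive.

Import Order.TTheory GRing.Theory Num.Theory.
Import numFieldNormedType.Exports.
Local Open Scope ring_scope.

(* Symmetry is not part of [posdef]. *)
Definition posdef (R : realType) (n : nat) (A : 'M[R]_n) : Prop :=
  forall x : 'cV[R]_n, x != 0 -> 0 < (x^T *m A *m x) 0 0.

Definition sym_posdef (R : realType) (n : nat) (A : 'M[R]_n) : Prop :=
  A^T = A /\ posdef A.

Definition saddle_mx (R : realType) (n m : nat)
    (A : 'M[R]_n) (B : 'M[R]_(m, n)) : 'M[R]_(n + m) :=
  block_mx A B^T (- B) 0.

Definition prec_mx (R : realType) (n m : nat)
    (A : 'M[R]_n) (B : 'M[R]_(m, n)) (Q : 'M[R]_m) (H : 'M[R]_n)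
    : 'M[R]_(n + m) :=
  block_mx H 0 0 Q + saddle_mx A B.

Definition complex_char_poly (R : realType) (n : nat) (M : 'M[R]_n)
    : {poly R[i]} :=
  char_poly (map_mx (real_complex R) M).

Lemma posdef_unitmx (R : realType) (n : nat) (A : 'M[R]_n) :
  posdef A -> A \in unitmx.
Proof.
move=> pA; rewrite unitmxE unitfE; apply/det0P => -[v v0 vA].
have := pA v^T; rewrite trmxK vA mul0mx mxE ltxx trmx_eq0 => /(_ v0).
by [].
Qed.

(* [invmx M] is M itself when M is singular; by this lemma it is the true
   inverse for M = prec_mx A B Q H. *)
Lemma prec_mx_unitmx (R : realType) (n m : nat)
    (A : 'M[R]_n) (B : 'M[R]_(m, n)) (Q : 'M[R]_m) (H : 'M[R]_n) :
  posdef A -> posdef Q -> posdef H -> prec_mx A B Q H \in unitmx.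
Proof.
move=> pA pQ pH; apply: posdef_unitmx => z.
rewrite -[z]vsubmxK; set x := usubmx z; set y := dsubmx z => z0.
rewrite /prec_mx /saddle_mx add_block_mx !add0r addr0 tr_col_mx.
rewrite mul_row_block mul_row_col !mulmxDl mulmxN mulNmx.
have -> : (y^T *m B *m x) = (x^T *m B^T *m y).
  rewrite -[RHS]trmxK [X in _ = X^T](_ : _ = y^T *m B *m x); last first.
    by rewrite !trmx_mul !trmxK mulmxA.
  by apply/matrixP => i j; rewrite [RHS]mxE !ord1.
set c := x^T *m B^T *m y.
have -> : x^T *m (H + A) *m x - c + (c + y^T *m Q *m y)
        = x^T *m H *m x + x^T *m A *m x + y^T *m Q *m y.
  by rewrite addrA subrK mulmxDr mulmxDl.
have ge0 k (M : 'M[R]_k) (u : 'cV[R]_k) : posdef M -> 0 <= (u^T *m M *m u) 0 0.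
  move=> pM; have [->|u0] := eqVneq u 0; first by rewrite mulmx0 mxE.
  exact/ltW/pM.
have -> (a b d : 'M[R]_1) : (a + b + d) 0 0 = a 0 0 + b 0 0 + d 0 0.
  by rewrite !mxE.
have [x0|x0] := eqVneq x 0.
  have y0 : y != 0.
    by apply: contra z0 => /eqP ->; rewrite x0 col_mx0.
  by apply: ltr_wpDl; [apply: addr_ge0; exact: ge0 | exact: pQ].
by apply: ltr_wpDr; [exact: ge0 | apply: addr_gt0; [exact: pH | exact: pA]].
Qed.

(* Main.v *)
(* If [u S = mu u P] with [P = D + S], [D = diag(H, Q)] and [S] the saddle point
   matrix, pairing with [u^*] gives [r = mu (q + r)], where [r = u S u^*] has
   nonnegative real part and [q = u D u^*] is positive, so every eigenvalue has
   the required form. As [a -> 0] the characteristic polynomial tends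
   coefficientwise to [\det(P0)^-1 \det(X P0 - S)] with [P0 = diag(0, Q) + S];
   there the first [n] rows of [X P0 - S] are [(X - 1) (A, B^T)], so
   [(X - 1)^n] divides the limit. If monic [p] of degree [N] tends to
   [p0] with [p0(c) = 0], some root [z] of [p] has [|c - z|^N <= |p(c)|], hence
   [z -> c], and the quotients by [X - z] tend to [p0 / (X - c)]; iterating [n]
   times extracts [n] roots tending to [1]. *)
Require Import Defs.
From mathcomp Require Import all_boot all_order all_algebra.
From mathcomp Require Import complex.
From mathcomp Require Import all_classical all_reals all_analysis.
Import Order.TTheory GRing.Theory Num.Theory.
Import numFieldNormedType.Exports.
Local Open Scope classical_set_scope.
Local Open Scope ring_scope.
Local Open Scope complex_scope.

(** * Coefficientwise convergence of polynomials along a filter *)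

Definition coef_cvg {K : numFieldType} {T : Type} (F : set_system T)
    (p : T -> {poly K}) (p0 : {poly K}) : Prop :=
  forall k, (p a)`_k @[a --> F] --> p0`_k.

Section CoefCvg.
Context {K : numFieldType} {T : Type} {F : set_system T} {FF : Filter F}.
Implicit Types (p q : T -> {poly K}).

Lemma cvg_sum_seq {I : Type} (r : seq I) (f : I -> T -> K) (l : I -> K) :
  (forall i, f i a @[a --> F] --> l i) ->
  \sum_(i <- r) f i a @[a --> F] --> \sum_(i <- r) l i.
Proof. by move=> fl; apply: cvg_big => // x; exact: add_continuous. Qed.

Lemma coef_cvg_cst (p0 : {poly K}) : coef_cvg F (fun=> p0) p0.
Proof. by move=> k; exact: cvg_cst. Qed.

Lemma coef_cvgD {p q} {p0 q0 : {poly K}} : coef_cvg F p p0 -> coef_cvg F q q0 ->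
  coef_cvg F (fun a => p a + q a) (p0 + q0).
Proof.
by move=> pp qq k; rewrite coefD; under eq_cvg do rewrite coefD; exact: cvgD.
Qed.

Lemma coef_cvgM {p q} {p0 q0 : {poly K}} : coef_cvg F p p0 -> coef_cvg F q q0 ->
  coef_cvg F (fun a => p a * q a) (p0 * q0).
Proof.
move=> pp qq k; rewrite coefM; under eq_cvg do rewrite coefM.
by apply: cvg_sum_seq => i; exact: cvgM.
Qed.

Lemma coef_cvgC {f : T -> K} {l : K} : f a @[a --> F] --> l ->
  coef_cvg F (fun a => (f a)%:P) l%:P.
Proof.
move=> fl [|k]; rewrite coefC /=; under eq_cvg do rewrite coefC //=.
  exact: fl.
exact: cvg_cst.
Qed.

Lemma coef_cvg_sum {I : Type} (r : seq I) (p : I -> T -> {poly K})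
    (l : I -> {poly K}) : (forall i, coef_cvg F (p i) (l i)) ->
  coef_cvg F (fun a => \sum_(i <- r) p i a) (\sum_(i <- r) l i).
Proof.
move=> pl k; rewrite coef_sum; under eq_cvg do rewrite coef_sum.
by apply: cvg_sum_seq => i; exact: pl.
Qed.

Lemma coef_cvg_prod {I : Type} (r : seq I) (p : I -> T -> {poly K})
    (l : I -> {poly K}) : (forall i, coef_cvg F (p i) (l i)) ->
  coef_cvg F (fun a => \prod_(i <- r) p i a) (\prod_(i <- r) l i).
Proof.
move=> pl; elim: r => [|i r IHr].
  by rewrite big_nil; under eq_fun do rewrite big_nil; exact: coef_cvg_cst.
rewrite big_cons; under eq_fun do rewrite big_cons.
exact: coef_cvgM.
Qed.

(** The Leibniz formula is a finite sum of finite products of entries. *)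
Lemma coef_cvg_det {n : nat} (M : T -> 'M[{poly K}]_n) (M0 : 'M[{poly K}]_n) :
  (forall i j, coef_cvg F (fun a => M a i j) (M0 i j)) ->
  coef_cvg F (fun a => \det (M a)) (\det M0).
Proof.
move=> MM; apply: coef_cvg_sum => s.
by apply: coef_cvgM; [exact: coef_cvg_cst | exact: coef_cvg_prod].
Qed.

(** The uniform bound on the sizes turns evaluation into a sum over one fixed finite range of
    coefficients. *)
Lemma cvg_horner {p} {p0 : {poly K}} (N : nat) (c : K) :
  (forall a, size (p a) <= N)%N ->
  coef_cvg F p p0 -> (p a).[c] @[a --> F] --> p0.[c].
Proof.
move=> sp pp0; rewrite (horner_coef_wide _ (leq_maxr N (size p0))).
under eq_cvg do
  rewrite (horner_coef_wide _ (leq_trans (sp _) (leq_maxl N (size p0)))).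
by apply: cvg_sum_seq => i; apply: cvgM; [exact: pp0 | exact: cvg_cst].
Qed.

(* Synthetic division: [q_k = p_(k+1) + z q_(k+1)], from the top degree down. *)
Lemma coef_cvg_div_XsubC {z : T -> K} {c : K} {q} {q0 : {poly K}} (N : nat) :
  (forall a, size (q a) <= N)%N -> z a @[a --> F] --> c ->
  coef_cvg F (fun a => ('X - (z a)%:P) * q a) (('X - c%:P) * q0) ->
  coef_cvg F q q0.
Proof.
move=> sq zc pp0.
have coefE (x : K) (r : {poly K}) k :
    r`_k = (('X - x%:P) * r)`_k.+1 + x * r`_k.+1.
  by rewrite mulrBl coefB coefXM coefCM subrK.
suff H j k : (maxn N (size q0) <= k + j)%N -> (q a)`_k @[a --> F] --> q0`_k.
  by move=> k; apply: (H (maxn N (size q0))); rewrite leq_addl.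
elim: j k => [|j IHj] k.
  rewrite addn0 geq_max => /andP[Nk q0k]; rewrite (nth_default _ q0k).
  under eq_cvg do rewrite nth_default ?(leq_trans (sq _) Nk)//.
  exact: cvg_cst.
rewrite addnS -addSn => /IHj qk.
rewrite (coefE c); under eq_cvg => a do rewrite (coefE (z a)).
by apply: cvgD; [exact: pp0 | exact: cvgM].
Qed.

End CoefCvg.

(** * Extraction of roots that converge to a root of the limit *)

Section RootsCvg.
Context {K : numClosedFieldType}.

Lemma monic_split {p : {poly K}} (n : nat) : p \is monic -> size p = n.+1 ->
  exists s : n.-tuple K, p = \prod_(i < n) ('X - (tnth s i)%:P).
Proof.
move=> /monicP p1 sp; have [s] := closed_field_poly_normal p.
rewrite p1 scale1r => ps.
have ss : size s == n by rewrite -eqSS -(size_prod_XsubC s id) -ps sp.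
exists (Tuple ss).
by rewrite ps -(big_tuple _ _ (Tuple ss) xpredT (fun z => 'X - z%:P)).
Qed.

(** As [p] is monic, [|p.[c]|] is the product of the [n.+1] distances from [c] to the roots, so the
    [n.+1]-th powers of these distances cannot all exceed it. *)
Lemma close_root {p : {poly K}} (n : nat) (c : K) :
  p \is monic -> size p = n.+2 ->
  exists z, root p z /\ `|c - z| ^+ n.+1 <= `|p.[c]|.
Proof.
move=> pm sp; have [s ps] := monic_split n.+1 pm sp.
have [[i hi]|no_close] := pselect (exists i, `|c - tnth s i| ^+ n.+1 <= `|p.[c]|).
  exists (tnth s i); split=> //.
  by rewrite ps rootE horner_prod; apply/prodf_eq0; exists i => //;
    rewrite hornerXsubC subrr.
have lt_root i : `|p.[c]| < `|c - tnth s i| ^+ n.+1.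
  (* The order of [K] is partial; both sides are comparable because they are real. *)
  rewrite real_ltNge ?normr_real ?rpredX ?normr_real//.
  by apply/negP => le_root; apply: no_close; exists i.
have : \prod_(i < n.+1) `|p.[c]| < \prod_(i < n.+1) `|c - tnth s i| ^+ n.+1.
  apply: ltr_prod => [|i _]; last by rewrite normr_ge0 lt_root.
  by apply/hasP; exists ord0 => //; exact: mem_index_enum.
rewrite prodr_const card_ord prodrXl -normr_prod.
rewrite ps horner_prod; under eq_bigr do rewrite hornerXsubC.
by rewrite ltxx.
Qed.

(** The roots are chosen separately for each [a], with no continuity in [a]: the bound of
    [close_root] alone forces convergence. *)
Lemma roots_cvg {T : Type} {F : set_system T} {FF : Filter F} (n m : nat)
    (p : T -> {poly K}) (c : K) (h : {poly K}) :
  (forall a, p a \is monic) -> (forall a, size (p a) = (n + m).+1) ->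
  coef_cvg F p (('X - c%:P) ^+ n * h) ->
  exists (lambda : 'I_n -> T -> K) (gamma : 'I_m -> T -> K),
    (forall a, p a = (\prod_(i < n) ('X - (lambda i a)%:P))
                   * (\prod_(j < m) ('X - (gamma j a)%:P))) /\
    forall i, lambda i a @[a --> F] --> c.
Proof.
elim: n p => [|n IHn] p pm sp pcvg.
  have /choice[s ps] a := monic_split m (pm a) (sp a).
  (* Nothing has to converge here: the first witness is a dummy on the empty ['I_0], and the [m]
     roots come in any order. *)
  exists (fun _ _ => 0), (fun j a => tnth (s a) j); split=> [a|[]//].
  by rewrite big_ord0 mul1r.
have zq a : exists zq : K * {poly K}, [/\ p a = ('X - zq.1%:P) * zq.2,
    zq.2 \is monic, size zq.2 = (n + m).+1
    & `|c - zq.1| ^+ (n + m).+1 <= `|(p a).[c]|].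
  have [z [/factor_theorem[q pq] cz]] := close_root (n + m) c (pm a) (sp a).
  have qm : q \is monic.
    by rewrite -(monicMr _ (monicXsubC z)) -pq.
  exists (z, q); split=> //=; first by rewrite mulrC.
  have := sp a; rewrite pq size_Mmonic ?monicXsubC ?monic_neq0//.
  by rewrite size_XsubC addn2 /= addSn => -[].
have {zq}/choice[f fP] := zq.
pose z a := (f a).1; pose q a := (f a).2.
have pzq a : p a = ('X - (z a)%:P) * q a by have [] := fP a.
have qm a : q a \is monic by have [] := fP a.
have sq a : size (q a) = (n + m).+1 by have [] := fP a.
have zc : z a @[a --> F] --> c.
  apply/cvgrPdist_lt => e e0.
  have sp_le a : (size (p a) <= (n.+1 + m).+1)%N by rewrite sp.
  have pc : (p a).[c] @[a --> F] --> (0 : K).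
    have := cvg_horner _ c sp_le pcvg.
    by rewrite hornerM exprS hornerM hornerXsubC subrr !mul0r => /(_ FF).
  have := cvgr_dist_lt _ _ pc _ (exprn_gt0 (n + m).+1 e0).
  move=> /(_ FF); apply: filterS => a; rewrite sub0r normrN => pe.
  rewrite -(ltr_pXn2r (ltn0Sn (n + m))) ?nnegrE ?normr_ge0 ?ltW//.
  by apply: le_lt_trans pe; have [] := fP a.
have qcvg : coef_cvg F q (('X - c%:P) ^+ n * h).
  have sq_le a : (size (q a) <= (n + m).+1)%N by rewrite sq.
  apply: (coef_cvg_div_XsubC _ sq_le zc).
  by rewrite mulrA -exprS -(funext pzq).
have [lambda [gamma [qE lambdac]]] := IHn q qm sq qcvg.
exists (fun i => if unlift ord0 i is Some j then lambda j else z), gamma.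
split=> [a|i]; last by case: unliftP => [j _|_]; [exact: lambdac | exact: zc].
rewrite big_ord_recl unlift_none -mulrA pzq qE; congr (_ * (_ * _)).
by apply: eq_bigr => i _; rewrite liftK.
Qed.

End RootsCvg.

(** * The characteristic polynomial of the preconditioned matrix and its limit *)

Lemma char_poly_invmx_mul {K : fieldType} {n : nat} (P S : 'M[K]_n) :
  P \in unitmx -> char_poly (invmx P *m S)
    = (\det P)^-1%:P * \det ('X *: map_mx polyC P - map_mx polyC S).
Proof.
(* Factor [X P - S = P (X - P^-1 S)] and take determinants; the pencil is affine in [P], so its
   limit can be taken entrywise. *)
move=> uP; have dP : \det P != 0 by rewrite -unitfE -unitmxE.
have -> : 'X *: map_mx polyC P - map_mx polyC S
    = map_mx polyC P *m char_poly_mx (invmx P *m S).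
  rewrite /char_poly_mx mulmxBr -map_mxM mulmxA mulmxV// mul1mx.
  by rewrite mul_mx_scalar.
by rewrite det_mulmx det_map_mx mulrA -polyCM mulVf// mul1r.
Qed.

Lemma det_prec_pencil0 {R : realType} {n m : nat}
    (A : 'M[R]_n) (B : 'M[R]_(m, n)) (Q : 'M[R]_m) :
  exists h : {poly R},
    \det ('X *: map_mx polyC (prec_mx A B Q 0)
          - map_mx polyC (saddle_mx A B)) = ('X - 1%:P) ^+ n * h.
Proof.
pose c := map_mx (@polyC R).
(* The pencil with [X - 1] taken out of its first [n] rows; left multiplication by the block
   diagonal matrix of [X - 1] and [1] restores it. *)
exists (\det (block_mx (c _ _ A) (c _ _ B^T) (('X - 1%:P) *: c _ _ (- B))
                       ('X *: c _ _ Q))).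
rewrite -[in RHS]det_scalar -[X in X * _]mulr1 -(det1 _ m) -(det_ublock _ 0).
rewrite -det_mulmx /prec_mx /saddle_mx add_block_mx !add0r addr0.
rewrite !map_block_mx scale_block_mx opp_block_mx add_block_mx mulmx_block.
rewrite !mul0mx !addr0 !add0r !mul_scalar_mx scale1r.
by rewrite !scalerBl !scale1r map_mx0 oppr0 addr0.
Qed.

Lemma posdef_sqr_ge0 {R : realType} {n : nat} {M : 'M[R]_n} (x : 'cV[R]_n) :
  posdef M -> 0 <= (x^T *m M *m x) 0 0.
Proof.
move=> pM; have [->|x0] := eqVneq x 0; first by rewrite mulmx0 mxE.
exact/ltW/pM.
Qed.

Lemma prec_mx0_unitmx {R : realType} {n m : nat}
    (A : 'M[R]_n) (B : 'M[R]_(m, n)) (Q : 'M[R]_m) :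
  posdef A -> posdef Q -> prec_mx A B Q 0 \in unitmx.
Proof.
move=> pA pQ.
have pA2 : posdef (2^-1 *: A).
  by move=> x x0; rewrite -scalemxAr -scalemxAl mxE mulr_gt0 ?invr_gt0 ?pA.
(* [prec_mx_unitmx] wants a positive definite [H]: take half of [A]. *)
suff -> : prec_mx A B Q 0 = prec_mx (2^-1 *: A) B Q (2^-1 *: A).
  exact: prec_mx_unitmx.
rewrite /prec_mx /saddle_mx !add_block_mx !add0r; congr block_mx.
by rewrite -scalerDl -mulr2n -[_ *+ 2]mulr_natr mulVf ?pnatr_eq0// scale1r.
Qed.

Lemma coef_cvg_char_poly {R : realType} {n m : nat}
    {A : 'M[R]_n} {B : 'M[R]_(m, n)} {Q : 'M[R]_m} {H : R -> 'M[R]_n} :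
  posdef A -> posdef Q -> (forall a, 0 < a -> posdef (H a)) ->
  H a @[a --> 0^'+] --> (0 : 'M[R]_n) ->
  exists h : {poly R}, coef_cvg (0 : R)^'+
    (fun a => char_poly (invmx (prec_mx A B Q (H a)) *m saddle_mx A B))
    (('X - 1%:P) ^+ n * h).
Proof.
move=> pA pQ pH Hcvg.
pose P a := prec_mx A B Q (H a); pose P0 := prec_mx A B Q 0.
have Hij i j : H a i j @[a --> 0^'+] --> (0 : R).
  have := cvg_comp _ _ Hcvg (@coord_continuous R n n i j 0).
  by rewrite mxE.
have Pij i j : P a i j @[a --> 0^'+] --> P0 i j.
  rewrite /P0 /prec_mx mxE; under eq_cvg do rewrite /P /prec_mx mxE.
  apply: cvgD; last exact: cvg_cst.
  case: (split_ordP i) (split_ordP j) => i' -> [] j' ->.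
  - by rewrite block_mxEul mxE; under eq_cvg do rewrite block_mxEul; exact: Hij.
  - by rewrite block_mxEur; under eq_cvg do rewrite block_mxEur; exact: cvg_cst.
  - by rewrite block_mxEdl; under eq_cvg do rewrite block_mxEdl; exact: cvg_cst.
  - by rewrite block_mxEdr; under eq_cvg do rewrite block_mxEdr; exact: cvg_cst.
have uP0 : P0 \in unitmx by exact: prec_mx0_unitmx.
have dP : (\det (P a))^-1 @[a --> 0^'+] --> (\det P0)^-1.
  apply: cvgV; first by rewrite -unitfE -unitmxE.
  (* The scalar determinant is read as a constant polynomial, so that coefficient [0] of
     [coef_cvg_det] gives its limit. *)
  have /(_ 0%N) : coef_cvg (0 : R)^'+ (fun a => \det (map_mx polyC (P a)))
      (\det (map_mx polyC P0)).
    apply: coef_cvg_det => i j; rewrite mxE; under eq_fun do rewrite mxE.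
    exact: coef_cvgC.
  by rewrite det_map_mx coefC; under eq_cvg do rewrite det_map_mx coefC.
have [h hE] := det_prec_pencil0 A B Q.
exists ((\det P0)^-1%:P * h); rewrite mulrCA -hE.
have lim : coef_cvg (0 : R)^'+ (fun a => (\det (P a))^-1%:P
      * \det ('X *: map_mx polyC (P a) - map_mx polyC (saddle_mx A B)))
    ((\det P0)^-1%:P
      * \det ('X *: map_mx polyC P0 - map_mx polyC (saddle_mx A B))).
  apply: coef_cvgM; first exact: coef_cvgC.
  have pencilE (M S : 'M[R]_(n + m)) i j :
      ('X *: map_mx polyC M - map_mx polyC S) i j
      = 'X * (M i j)%:P - (S i j)%:P by rewrite !mxE.
  apply: coef_cvg_det => i j; rewrite pencilE; under eq_fun do rewrite pencilE.
  apply: coef_cvgD; last exact: coef_cvg_cst.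
  by apply: coef_cvgM; [exact: coef_cvg_cst | exact: coef_cvgC].
move=> k; apply: cvg_trans (lim k).
(* The pencil formula requires [P a] nonsingular, which [a > 0] ensures; this holds near [0^'+]. *)
apply: near_eq_cvg; near=> a.
by rewrite char_poly_invmx_mul// prec_mx_unitmx//; apply: pH.
Unshelve. all: by end_near. Qed.

Lemma cvg_real_complex {R : realType} {T : Type} {F : set_system T}
    {FF : Filter F} {f : T -> R} {l : R} :
  f a @[a --> F] --> l -> (f a)%:C @[a --> F] --> (l%:C : R[i]^o).
Proof.
move=> fl; apply/(@cvgrPdist_lt _ R[i]^o) => e e0.
(* A positive element of [R[i]] is real, so [e] serves as a radius in [R] too. *)
have [re] : exists re, e = re%:C.
  by exists (complex.Re e); rewrite RRe_real ?gtr0_real.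
move=> eE; rewrite eE ltcR in e0 *.
have := cvgr_dist_lt _ _ fl _ e0 => /(_ FF); apply: filterS => a.
by rewrite -rmorphB normc_def/= expr0n addr0 sqrtr_sqr ltcR.
Qed.

(** * Hermitian forms and the shape of the eigenvalues *)

Local Notation toC := (map_mx (real_complex _)).

(** This is [v^* W v] for [v = x + i y]: real positivity of [W] passes to the real part, and
    symmetry of [W] kills the imaginary part. *)
Lemma hermitian_formE {R : realType} {n : nat} (W : 'M[R]_n) (x y : 'cV[R]_n) :
  ((toC x - 'i *: toC y)^T *m toC W *m (toC x + 'i *: toC y)) 0 0
  = ((x^T *m W *m x) 0 0 + (y^T *m W *m y) 0 0)
    +i* ((x^T *m W *m y) 0 0 - (y^T *m W *m x) 0 0).
Proof.
have E (u v : 'cV[R]_n) :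
    ((toC u)^T *m toC W *m toC v) 0 0 = ((u^T *m W *m v) 0 0)%:C.
  by rewrite map_trmx -!map_mxM mxE.
have addE (M N : 'M[R[i]]_1) : (M + N) 0 0 = M 0 0 + N 0 0 by rewrite mxE.
have oppE (M : 'M[R[i]]_1) : (- M) 0 0 = - M 0 0 by rewrite mxE.
have scaleE c (M : 'M[R[i]]_1) : (c *: M) 0 0 = c * M 0 0 by rewrite mxE.
rewrite linearB linearZ /= !(mulmxDl, mulmxDr, mulNmx).
rewrite -!(scalemxAl, scalemxAr) !(addE, oppE, scaleE) !E.
by simpc; congr Complex; exact: addrC.
Qed.

(** The minus sign makes [u] the conjugate transpose of [x + i y], the left factor in
    [hermitian_formE]. *)
Lemma row_re_im {R : realType} {n : nat} (u : 'rV[R[i]]_n) :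
  exists x y : 'cV[R]_n, u = (toC x - 'i *: toC y)^T.
Proof.
exists (map_mx (@complex.Re R) u)^T, (- map_mx (@complex.Im R) u)^T.
by apply/matrixP => i j; rewrite !mxE; case: (u i j) => a b /=; simpc.
Qed.

Lemma trmx11 {V : Type} (M : 'M[V]_1) : M^T = M.
Proof. by apply/matrixP => i j; rewrite mxE !ord1. Qed.

(** The blocks [B^T] and [- B] form a skew-symmetric part, whose contributions cancel; only the form
    of [A] at the upper part of [z] remains. *)
Lemma saddle_mx_sqr_ge0 {R : realType} {n m : nat}
    {A : 'M[R]_n} (B : 'M[R]_(m, n)) (z : 'cV[R]_(n + m)) :
  posdef A -> 0 <= (z^T *m saddle_mx A B *m z) 0 0.
Proof.
move=> pA; rewrite -[z]vsubmxK; set x := usubmx z; set y := dsubmx z.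
rewrite /saddle_mx tr_col_mx mul_row_block mul_row_col mulmx0 addr0.
rewrite !mulmxDl mulmxN mulNmx.
have -> : y^T *m B *m x = x^T *m B^T *m y.
  by rewrite -(trmx11 (y^T *m B *m x)) !trmx_mul trmxK mulmxA.
by rewrite subrK posdef_sqr_ge0.
Qed.

Lemma sym_posdef_block_diag {R : realType} {n m : nat}
    {H : 'M[R]_n} {Q : 'M[R]_m} :
  sym_posdef H -> sym_posdef Q -> sym_posdef (block_mx H 0 0 Q).
Proof.
move=> [sH pH] [sQ pQ]; split; first by rewrite tr_block_mx sH sQ !trmx0.
move=> z; rewrite -[z]vsubmxK; set x := usubmx z; set y := dsubmx z => z0.
rewrite tr_col_mx mul_row_block mul_row_col !mulmx0 addr0 add0r mxE.
have [x0|x0] := eqVneq x 0.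
  apply: ltr_wpDl; first exact: posdef_sqr_ge0.
  by apply: pQ; apply: contra_neq z0 => y0; rewrite x0 y0 col_mx0.
by apply: ltr_wpDr; [exact: posdef_sqr_ge0 | exact: pH].
Qed.

Lemma prec_eigenvalueE {R : realType} {n m : nat} {A : 'M[R]_n}
    {B : 'M[R]_(m, n)} {Q : 'M[R]_m} {H : 'M[R]_n} {mu : R[i]} :
  posdef A -> sym_posdef Q -> sym_posdef H ->
  root (complex_char_poly (invmx (prec_mx A B Q H) *m saddle_mx A B)) mu ->
  exists (r : R[i]) (q : R),
    [/\ 0 <= complex.Re r, 0 < q & mu = r / (q%:C + r)].
Proof.
move=> pA sQ sH; set S := saddle_mx A B; set P := prec_mx A B Q H.
rewrite /complex_char_poly -eigenvalue_root_char => /eigenvalueP[w].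
rewrite map_mxM map_invmx => wE w0.
pose D := block_mx H 0 0 Q.
have uP : toC P \in unitmx.
  by rewrite map_unitmx; apply: prec_mx_unitmx; [|case: sQ|case: sH].
(* This substitution turns the left eigenvector equation for [P^-1 S] into [u S = mu u P]. *)
pose u := w *m invmx (toC P).
have u0 : u != 0.
  by apply: contra_neq w0 => u0; rewrite -[w](mulmxKV uP) -/u u0 mul0mx.
have uS : u *m toC S = mu *: (u *m toC P).
  by rewrite /u mulmxKV// -mulmxA wE.
have [x [y uE]] := row_re_im u.
pose v := toC x + 'i *: toC y.
pose form W := (u *m toC W *m v) 0 0.
have formE W := hermitian_formE W x y.
have [symD posD] : sym_posdef D := sym_posdef_block_diag sH sQ.
pose q := (x^T *m D *m x) 0 0 + (y^T *m D *m y) 0 0.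
have qE : form D = q%:C.
  rewrite /form uE formE; congr Complex; apply/eqP; rewrite subr_eq0; apply/eqP.
  by rewrite -(trmx11 (y^T *m D *m x)) !trmx_mul trmxK symD mulmxA.
have q0 : 0 < q.
  have [x0|x0] := eqVneq x 0.
    apply: ltr_wpDl; first exact: posdef_sqr_ge0.
    apply: posD; apply: contra_neq u0 => y0.
    by rewrite uE x0 y0 !map_mx0 scaler0 subr0 trmx0.
  by apply: ltr_wpDr; [exact: posdef_sqr_ge0 | exact: posD].
have r0 : 0 <= complex.Re (form S).
  by rewrite /form uE formE /= addr_ge0// saddle_mx_sqr_ge0.
exists (form S), q; split=> //.
have formP : form P = q%:C + form S.
  rewrite -qE /form /P /prec_mx -/D -/S map_mxD.
  by rewrite (mulmxDr u) (mulmxDl _ _ v) [LHS]mxE.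
have formS : form S = mu * form P by rewrite {1}/form uS -scalemxAl mxE.
rewrite [X in X / _]formS -formP mulfK// formP.
(* The denominator is nonzero: otherwise its real part, [q] plus a nonnegative number, would
   vanish. *)
apply: contraTneq q0 => /(congr1 (@complex.Re R)).
rewrite raddfD /= => qr0; rewrite -leNgt.
by rewrite -qr0 lerDl.
Qed.

Theorem theorem3 (R : realType) (n m : nat) (le_mn : (m <= n)%N)
    (A : 'M[R]_n) (B : 'M[R]_(m, n)) (Q : 'M[R]_m) (H : R -> 'M[R]_n)
    (A_posdef : posdef A)
    (B_deficient : (\rank B < m)%N)
    (Q_spd : sym_posdef Q)
    (H_spd : forall a : R, 0 < a -> sym_posdef (H a))
    (H_cvg0 : H a @[a --> 0^'+] --> (0 : 'M[R]_n)) :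
  exists (lambda : 'I_n -> R -> R[i]) (gamma : 'I_m -> R -> R[i]),
    [/\ forall a : R, 0 < a ->
          complex_char_poly (invmx (prec_mx A B Q (H a)) *m saddle_mx A B)
          = (\prod_(i < n) ('X - (lambda i a)%:P))
            * (\prod_(j < m) ('X - (gamma j a)%:P)),
        forall i : 'I_n, lambda i a @[a --> 0^'+] --> (1 : R[i]^o)
      & forall (j : 'I_m) (a : R), 0 < a ->
          exists (r : R[i]) (q : R),
            [/\ 0 <= complex.Re r, 0 < q & gamma j a = r / (q%:C + r)]].
Proof.
pose p a := complex_char_poly (invmx (prec_mx A B Q (H a)) *m saddle_mx A B).
have [h pcvg] := coef_cvg_char_poly (B := B) A_posdef (proj2 Q_spd)
  (fun a a0 => proj2 (H_spd a a0)) H_cvg0.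
(* The limit is carried from [R], where the matrices live, to [R[i]], where polynomials split. *)
have pC : coef_cvg (0 : R)^'+ p
    (('X - 1%:P) ^+ n * map_poly (real_complex R) h).
  move=> k.
  rewrite -(rmorph1 (real_complex R)) -map_polyXsubC -rmorphXn -rmorphM.
  rewrite coef_map; under eq_cvg do
    rewrite /p /complex_char_poly -map_char_poly coef_map.
  exact/cvg_real_complex/pcvg.
(* [roots_cvg] asks this for every [a]; it holds for any characteristic polynomial, even where
   [prec_mx] might be singular. *)
have pm a : p a \is monic by exact: char_poly_monic.
have sp a : size (p a) = (n + m).+1 by exact: size_char_poly.
have [lambda [gamma [pE lambda1]]] := roots_cvg n m p 1 _ pm sp pC.
exists lambda, gamma; split=> [a _|i|j a a0]; [exact: pE|exact: lambda1|].
apply: (prec_eigenvalueE (B := B) A_posdef Q_spd (H_spd a a0)).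
rewrite -/(p a) pE rootM; apply/orP; right.
rewrite rootE horner_prod; apply/prodf_eq0; exists j => //.
by rewrite hornerXsubC subrr.
Qed.
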